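(* $$\sum_{k=0}^{\infty}\frac{\binom{2k}{k}^5}{(-2^{12})^k}\Big\{(20k^2+8k+1)H_k-6k-1\Big\}=-\frac{16\log 2}{\pi^2}.$$
   Context: For a nonnegative integer $n$, $H_n=\sum_{j=1}^{n}\frac{1}{j}$ denotes the classical harmonic number, with $H_0=0$. $\log$ is the natural logarithm. *)

(* Defs.v *)
From Stdlib Require Import Reals.
From Coquelicot Require Import Coquelicot.
Open Scope R_scope.

(* [sum_n_m] over the empty range [1..0] is zero, so [harmonic 0 = 0]. *)
Definition harmonic (n : nat) : R := sum_n_m (fun j : nat => / INR j) 1 n.

(* The name [C] is shadowed by Coquelicot's complex numbers. *)
Definition binom (n p : nat) : R := Binomial.C n p.

(* Main.v *)
Require Import Defs.
From Stdlib Require Import Factorial Reals Lra Lia.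
From Coquelicot Require Import Coquelicot.
Open Scope R_scope.

(** The summation is the derivative, with respect to a parameter, of a
    one-parameter extension of Guillera's series for 8/pi^2.  Write (a)_m for
    the rising factorial.  For every s the function
<<
    U_s(n,k) = (-1)^n (s)_(n+k) (s)_k (1-s)_n (1/2)_(n+k)^2 (1/2)_n^2
               / ((n+k)! n! (2n+k+1)! (s+1/2)_(n+k)^2) * P_s(n,k),
    P_s(n,k) = 8 k^3 + 8 (5n+1+s) k^2 + (72 n^2 + (32+24s) n + 2 + 8s) k
               + 2 (2n+1) (10 n^2 + (1+6s) n + s)
>>
    belongs to a Wilf-Zeilberger pair: U_s(n,k+1) - U_s(n,k) is the forward
    difference in n of an explicit function that vanishes at n = 0.  The pair
    comes from the shift (a,b,c,d,e) -> (a+2,b+1,c+1,d+1,e) in Dougall's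
    bilateral 5H5 sum, at a = b = e = s and c = d = 1/2.  With these parameters
    the logarithmic derivative of U_s(n,0) / P_s(n,0) at s = 1/2 is -2 H_n,
    with no sum over odd integers left in it.

    Only -1/2 times the s-derivative at s = 1/2 is used below: [wz_term] is
    this multiple for U_s and [wz_cert] the one for its companion.
    The relation between them ([wz_term_cert]) is a rational identity once the
    increments of the harmonic sums are inserted, so no differentiation is
    carried out.

    Summing the relation over n shows that the sum of [wz_term n k] over n does
    not depend on k.  At k = 0 it is the series of the theorem
    ([wz_term_k0]).  As k grows, all terms with n >= 1 vanish, dominated by a
    geometric series times 1/(k+1) ([wz_term_bound]), and the term n = 0 tends
    to the right-hand side ([is_lim_seq_wz_term_0]).  That limit combines
    Wallis' product, which supplies 1/pi^2, with the limit 2 log 2 of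
    2 (1 + 1/3 + ... + 1/(2k-1)) - H_k.  The passage to the limit is
    [wz_series]. *)

(** * Central binomial ratios and harmonic sums *)

Definition wallis_ratio (m : nat) : R := binom (2 * m) m / 4 ^ m.

Definition odd_harmonic (m : nat) : R :=
  sum_n_m (fun j : nat => / (2 * INR j - 1)) 1 m.

Lemma wallis_ratio_0 : wallis_ratio 0 = 1.
Proof. unfold wallis_ratio, binom, Binomial.C. simpl. field. Qed.

Lemma wallis_ratio_S (m : nat) :
  wallis_ratio (S m) = wallis_ratio m * ((2 * INR m + 1) / (2 * INR m + 2)).
Proof.
  unfold wallis_ratio, binom, Binomial.C.
  replace (2 * S m - S m)%nat with (S m) by lia.
  replace (2 * m - m)%nat with m by lia.
  replace (2 * S m)%nat with (S (S (2 * m))) by lia.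
  rewrite !fact_simpl, !mult_INR, !S_INR, !mult_INR.
  replace (INR 2) with 2 by (simpl; ring).
  replace (4 ^ S m) with (4 * 4 ^ m) by reflexivity.
  pose proof (INR_fact_neq_0 m). pose proof (INR_fact_neq_0 (2 * m)).
  pose proof (pos_INR m).
  assert (4 ^ m <> 0) by (apply pow_nonzero; lra).
  field. repeat split; try assumption; lra.
Qed.

Lemma wallis_ratio_pos (m : nat) : 0 < wallis_ratio m.
Proof.
  induction m as [|m IH]; [rewrite wallis_ratio_0; lra|].
  rewrite wallis_ratio_S. pose proof (pos_INR m).
  apply Rmult_lt_0_compat; [assumption|]. apply Rdiv_lt_0_compat; lra.
Qed.

Lemma harmonic_0 : harmonic 0 = 0.
Proof. exact (sum_n_m_zero _ 1 0 (le_n 1)). Qed.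

Lemma harmonic_S (m : nat) : harmonic (S m) = harmonic m + / (INR m + 1).
Proof. unfold harmonic. rewrite sum_n_Sm by lia. now rewrite S_INR. Qed.

Lemma odd_harmonic_0 : odd_harmonic 0 = 0.
Proof. exact (sum_n_m_zero _ 1 0 (le_n 1)). Qed.

Lemma odd_harmonic_S (m : nat) :
  odd_harmonic (S m) = odd_harmonic m + / (2 * INR m + 1).
Proof.
  unfold odd_harmonic. rewrite sum_n_Sm by lia. rewrite S_INR.
  now replace (2 * (INR m + 1) - 1) with (2 * INR m + 1) by ring.
Qed.

(** * Telescoping along a Wilf-Zeilberger pair *)

(** By the first two hypotheses the column sums over [n <= N] for [k] and
    [S k] differ by [G (S N) k], so the infinite column sums all agree.  The
    domination by [a n * e k] makes everything but the row [n = 0] disappear as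
    [k] grows, hence their common value is the limit of that row. *)
Lemma wz_series (F G : nat -> nat -> R) (a e : nat -> R) (l : R) :
  (forall n k, F n (S k) - F n k = G (S n) k - G n k) ->
  (forall k, G 0%nat k = 0) ->
  (forall k, is_lim_seq (fun n => G n k) 0) ->
  ex_series a ->
  is_lim_seq e 0 ->
  (forall n k, Rabs (F (S n) k) <= a n * e k) ->
  is_lim_seq (F 0%nat) l ->
  is_series (fun n => F n 0%nat) l.
Proof.
  intros HFG HG0 HG Ha He HF Hl.
  assert (Htail : forall k, ex_series (fun n => Rabs (F (S n) k))).
  { intros k. apply (@ex_series_le R_AbsRing R_CompleteNormedModule _
      (fun n => a n * e k)).
    - intros n. change (Rabs (Rabs (F (S n) k)) <= a n * e k).
      rewrite Rabs_Rabsolu. apply HF.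
    - now apply ex_series_scal_r. }
  assert (Hcol : forall k, ex_series (fun n => F n k)).
  { intros k. apply ex_series_incr_1. now apply ex_series_Rabs. }
  assert (Htel : forall k N,
    sum_n (fun n => F n (S k)) N = sum_n (fun n => F n k) N + G (S N) k).
  { intros k N. induction N as [|N IH].
    - rewrite !sum_O. specialize (HFG 0%nat k). rewrite HG0 in HFG. lra.
    - rewrite !sum_Sn, IH. specialize (HFG (S N) k).
      change plus with Rplus. lra. }
  assert (Hinv : forall k, Series (fun n => F n k) = Series (fun n => F n 0%nat)).
  { induction k as [|k IH]; [reflexivity|]. rewrite <- IH.
    apply is_series_unique. change (is_lim_seq (sum_n (fun n => F n (S k)))
      (Series (fun n => F n k))).
    apply is_lim_seq_ext with
      (fun N => sum_n (fun n => F n k) N + G (S N) k).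
    { intros N. now rewrite Htel. }
    replace (Finite (Series (fun n => F n k)))
      with (Rbar_plus (Series (fun n => F n k)) 0)
      by (simpl; now rewrite Rplus_0_r).
    apply is_lim_seq_plus'.
    - apply (Series_correct _ (Hcol k)).
    - apply (is_lim_seq_incr_1 (fun n => G n k)). apply HG. }
  assert (Hlim : is_lim_seq (F 0%nat) (Series (fun n => F n 0%nat))).
  { apply is_lim_seq_ext with
      (fun k => Series (fun n => F n 0%nat) - Series (fun n => F (S n) k)).
    { intros k. rewrite <- (Hinv k), (Series_incr_1 _ (Hcol k)). ring. }
    replace (Finite (Series (fun n => F n 0%nat)))
      with (Finite (Series (fun n => F n 0%nat) - 0)) by (f_equal; ring).
    apply is_lim_seq_minus'; [apply is_lim_seq_const|].
    apply is_lim_seq_abs_0.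
    apply is_lim_seq_le_le with (fun _ => 0) (fun k => Series a * e k).
    - intros k. split; [apply Rabs_pos|].
      eapply Rle_trans; [now apply Series_Rabs|].
      rewrite <- Series_scal_r. apply Series_le.
      + intros n. split; [apply Rabs_pos | apply HF].
      + now apply ex_series_scal_r.
    - apply is_lim_seq_const.
    - replace (Finite 0) with (Finite (Series a * 0)) by (f_equal; ring).
      apply (is_lim_seq_scal_l e (Series a) 0 He). }
  replace l with (Series (fun n => F n 0%nat)).
  - now apply Series_correct.
  - pose proof (is_lim_seq_unique _ _ Hl) as E1.
    rewrite (is_lim_seq_unique _ _ Hlim) in E1. congruence.
Qed.

(** * The differentiated pair *)

(** The value at s = 1/2 of U_s(n,k) / P_s(n,k), rewritten with
    (1/2)_m = m! [wallis_ratio m]. *)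
Definition weight (n k : nat) : R :=
  (-1) ^ n * wallis_ratio (n + k) ^ 3 * wallis_ratio n ^ 3 * wallis_ratio k *
  (INR (fact k) * INR (fact n) ^ 2 / INR (fact (2 * n + k + 1))).

(** -1/2 times the derivative of log (U_s(n,k) / P_s(n,k)) at s = 1/2. *)
Definition mixed_harmonic (n k : nat) : R :=
  harmonic (n + k) - odd_harmonic (n + k) - odd_harmonic k + odd_harmonic n.

(** The two polynomials are P_s(n,k) at s = 1/2 and half of its s-derivative;
    the minus sign is that of the factor -1/2. *)
Definition wz_term (n k : nat) : R :=
  let x := INR n in let y := INR k in
  weight n k *
  (mixed_harmonic n k *
     (8 * y ^ 3 + (40 * x + 12) * y ^ 2 + (72 * x ^ 2 + 44 * x + 6) * y
      + (2 * x + 1) * (20 * x ^ 2 + 8 * x + 1))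
   - (4 * y ^ 2 + (12 * x + 4) * y + (2 * x + 1) * (6 * x + 1))).

(** -1/2 times the derivative at s = 1/2 of
    8 n (2n+k+1) (2n+2k+s) U_s(n,k) / P_s(n,k), the companion of U_s. *)
Definition wz_cert (n k : nat) : R :=
  let x := INR n in let y := INR k in
  4 * x * (2 * x + y + 1) * weight n k *
  (mixed_harmonic n k * (4 * x + 4 * y + 1) - 1).

Lemma weight_Sk (n k : nat) :
  let x := INR n in let y := INR k in
  weight n (S k) =
  weight n k * (((2 * (x + y) + 1) / (2 * (x + y) + 2)) ^ 3
                * ((2 * y + 1) / (2 * y + 2)) * ((y + 1) / (2 * x + y + 2))).
Proof.
  intros x y. unfold weight.
  replace (n + S k)%nat with (S (n + k)) by lia.
  replace (2 * n + S k + 1)%nat with (S (2 * n + k + 1)) by lia.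
  rewrite !wallis_ratio_S, !fact_simpl, !mult_INR, !S_INR, !plus_INR, mult_INR.
  change (INR 1) with 1. replace (INR 2) with 2 by (simpl; ring).
  fold x y.
  pose proof (INR_fact_neq_0 (2 * n + k + 1)).
  assert (0 <= x) by apply pos_INR. assert (0 <= y) by apply pos_INR.
  field. repeat split; try assumption; lra.
Qed.

Lemma weight_Sn (n k : nat) :
  let x := INR n in let y := INR k in
  weight (S n) k =
  - weight n k * (((2 * (x + y) + 1) / (2 * (x + y) + 2)) ^ 3
                  * ((2 * x + 1) / (2 * x + 2)) ^ 3
                  * ((x + 1) ^ 2 / ((2 * x + y + 2) * (2 * x + y + 3)))).
Proof.
  intros x y. unfold weight.
  replace (S n + k)%nat with (S (n + k)) by lia.
  replace (2 * S n + k + 1)%nat with (S (S (2 * n + k + 1))) by lia.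
  rewrite !wallis_ratio_S, !fact_simpl, !mult_INR, !S_INR, !plus_INR, mult_INR.
  change (INR 1) with 1. replace (INR 2) with 2 by (simpl; ring).
  replace ((-1) ^ S n) with (- (-1) ^ n) by (simpl; ring).
  fold x y.
  pose proof (INR_fact_neq_0 (2 * n + k + 1)).
  assert (0 <= x) by apply pos_INR. assert (0 <= y) by apply pos_INR.
  field. repeat split; try assumption; lra.
Qed.

Lemma mixed_harmonic_Sk (n k : nat) :
  mixed_harmonic n (S k) =
  mixed_harmonic n k + / (INR n + INR k + 1) - / (2 * (INR n + INR k) + 1)
  - / (2 * INR k + 1).
Proof.
  unfold mixed_harmonic. replace (n + S k)%nat with (S (n + k)) by lia.
  rewrite harmonic_S, !odd_harmonic_S, plus_INR. ring.
Qed.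

Lemma mixed_harmonic_Sn (n k : nat) :
  mixed_harmonic (S n) k =
  mixed_harmonic n k + / (INR n + INR k + 1) - / (2 * (INR n + INR k) + 1)
  + / (2 * INR n + 1).
Proof.
  unfold mixed_harmonic. replace (S n + k)%nat with (S (n + k)) by lia.
  rewrite harmonic_S, !odd_harmonic_S, plus_INR. ring.
Qed.

(** Both sides are [weight n k] times an affine expression in
    [mixed_harmonic n k] with rational coefficients.  The coefficient of
    [mixed_harmonic n k] is the relation for the pair at s = 1/2; the remaining
    part is what differentiating its rational coefficients in s adds. *)
Lemma wz_term_cert (n k : nat) :
  wz_term n (S k) - wz_term n k = wz_cert (S n) k - wz_cert n k.
Proof.
  unfold wz_term, wz_cert.
  rewrite weight_Sk, weight_Sn, mixed_harmonic_Sk, mixed_harmonic_Sn, !S_INR.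
  pose proof (pos_INR n). pose proof (pos_INR k).
  generalize dependent (INR n). generalize dependent (INR k).
  intros y Hy x Hx.
  field. repeat split; lra.
Qed.

(** * Wallis' product *)

Lemma is_lim_seq_inv_affine (a b : R) :
  0 < a -> is_lim_seq (fun n => / (a * INR n + b)) 0.
Proof.
  intros Ha.
  apply (is_lim_seq_inv _ p_infty); [|discriminate].
  eapply is_lim_seq_plus; [|apply is_lim_seq_const|].
  - apply (is_lim_seq_scal_l INR a p_infty), is_lim_seq_INR.
  - unfold is_Rbar_plus. simpl. destruct (Rle_dec 0 a) as [H|H]; [|lra].
    destruct (Rle_lt_or_eq_dec 0 a H); [reflexivity|lra].
Qed.

Definition sin_integral (n : nat) : R := RInt (fun t => sin t ^ n) 0 (PI / 2).

Lemma sin_pow_continuous (n : nat) (t : R) : continuous (fun t => sin t ^ n) t.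
Proof.
  apply (@ex_derive_continuous R_AbsRing R_NormedModule). auto_derive. trivial.
Qed.

Lemma ex_RInt_sin_pow (n : nat) : ex_RInt (fun t => sin t ^ n) 0 (PI / 2).
Proof.
  apply (@ex_RInt_continuous R_CompleteNormedModule).
  intros t _. apply sin_pow_continuous.
Qed.

(** Integrate the derivative of sin^(n+1) cos, a function that vanishes at both
    ends of the interval. *)
Lemma sin_integral_SS (n : nat) :
  (INR n + 2) * sin_integral (S (S n)) = (INR n + 1) * sin_integral n.
Proof.
  set (h := fun t => (INR n + 1) * sin t ^ n - (INR n + 2) * sin t ^ S (S n)).
  assert (H1 : is_RInt h 0 (PI / 2) 0).
  { replace 0 with (minus (sin (PI / 2) ^ S n * cos (PI / 2))
                          (sin 0 ^ S n * cos 0)) at 2.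
    - apply (is_RInt_derive (fun t => sin t ^ S n * cos t) h).
      + intros t _. unfold h. auto_derive; [trivial|].
        change (match n with 0%nat => 1 | S _ => INR n + 1 end) with (INR (S n)).
        pose proof (sin2_cos2 t) as E. unfold Rsqr in E.
        replace (sin t ^ S (S n)) with (sin t * sin t * sin t ^ n) by (simpl; ring).
        rewrite S_INR.
        replace (1 * cos t * ((INR n + 1) * sin t ^ n) * cos t)
          with ((INR n + 1) * sin t ^ n * (cos t * cos t)) by ring.
        replace (cos t * cos t) with (1 - sin t * sin t) by lra.
        ring.
      + intros t _. apply (@ex_derive_continuous R_AbsRing R_NormedModule).
        unfold h. auto_derive. trivial.
    - rewrite cos_PI2, sin_0. unfold minus, plus, opp. simpl. ring. }
  assert (H2 : is_RInt h 0 (PI / 2)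
    (minus (scal (INR n + 1) (sin_integral n))
           (scal (INR n + 2) (sin_integral (S (S n)))))).
  { apply @is_RInt_minus; apply @is_RInt_scal; apply @RInt_correct;
      apply ex_RInt_sin_pow. }
  apply (@is_RInt_unique R_CompleteNormedModule) in H1, H2. rewrite H1 in H2.
  change (0 = (INR n + 1) * sin_integral n
              + - ((INR n + 2) * sin_integral (S (S n)))) in H2.
  lra.
Qed.

Lemma sin_integral_decr (n : nat) : sin_integral (S n) <= sin_integral n.
Proof.
  pose proof PI_RGT_0.
  apply RInt_le; try apply ex_RInt_sin_pow; [lra|].
  intros t Ht. simpl.
  assert (0 <= sin t) by (apply sin_ge_0; lra).
  pose proof (SIN_bound t). pose proof (pow_le (sin t) n ltac:(assumption)). nra.
Qed.

Lemma sin_integral_even (m : nat) : sin_integral (2 * m) = PI / 2 * wallis_ratio m.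
Proof.
  induction m as [|m IH].
  - unfold sin_integral. rewrite wallis_ratio_0. simpl. rewrite RInt_const.
    unfold scal. simpl. unfold mult. simpl. ring.
  - replace (2 * S m)%nat with (S (S (2 * m))) by lia.
    pose proof (sin_integral_SS (2 * m)) as E. rewrite IH in E.
    rewrite mult_INR in E. replace (INR 2) with 2 in E by (simpl; ring).
    pose proof (pos_INR m). rewrite wallis_ratio_S.
    apply (Rmult_eq_reg_l (2 * INR m + 2)); [|lra]. rewrite E. field. lra.
Qed.

Lemma sin_integral_odd (m : nat) :
  sin_integral (S (2 * m)) = / ((2 * INR m + 1) * wallis_ratio m).
Proof.
  induction m as [|m IH].
  - unfold sin_integral. rewrite wallis_ratio_0.
    replace (/ ((2 * INR 0 + 1) * 1)) with (minus (- cos (PI / 2)) (- cos 0)).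
    + apply is_RInt_unique. apply (is_RInt_derive (fun t => - cos t)).
      * intros t _. auto_derive; [trivial|]. simpl. ring.
      * intros t _. apply sin_pow_continuous.
    + rewrite cos_PI2, cos_0. unfold minus, plus, opp. simpl. field.
  - replace (S (2 * S m))%nat with (S (S (S (2 * m)))) by lia.
    pose proof (sin_integral_SS (S (2 * m))) as E. rewrite IH in E.
    rewrite S_INR, mult_INR in E. replace (INR 2) with 2 in E by (simpl; ring).
    pose proof (pos_INR m). pose proof (wallis_ratio_pos m). rewrite wallis_ratio_S, S_INR.
    apply (Rmult_eq_reg_l (2 * INR m + 3)); [|lra].
    replace (2 * INR m + 3) with (2 * INR m + 1 + 2) at 1 by ring.
    rewrite E. field. repeat split; lra.
Qed.

(** Wallis' argument: the integrals decrease with the exponent, and those of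
    exponents 2m and 2m+1 are PI/2 times [wallis_ratio m] and the inverse of
    (2m+1) [wallis_ratio m]. *)
Lemma wallis_ratio_sq_bounds (m : nat) :
  2 / PI <= wallis_ratio m ^ 2 * (2 * INR m + 1) <= 2 / PI * (1 + / (2 * INR m + 1)).
Proof.
  pose proof (wallis_ratio_pos m) as Hw. pose proof (pos_INR m) as Hm. pose proof PI_RGT_0 as HP.
  pose proof (sin_integral_decr (2 * m)) as H1.
  pose proof (sin_integral_decr (S (2 * m))) as H2.
  replace (S (S (2 * m))) with (2 * S m)%nat in H2 by lia.
  rewrite sin_integral_even, sin_integral_odd in *.
  rewrite wallis_ratio_S in H2.
  split.
  - apply (Rmult_le_compat_l (2 / PI * ((2 * INR m + 1) * wallis_ratio m))) in H1.
    2:{ apply Rlt_le, Rmult_lt_0_compat;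
        [apply Rdiv_lt_0_compat; lra | apply Rmult_lt_0_compat; lra]. }
    replace (2 / PI * ((2 * INR m + 1) * wallis_ratio m) * / ((2 * INR m + 1) * wallis_ratio m))
      with (2 / PI) in H1 by (field; repeat split; lra).
    replace (2 / PI * ((2 * INR m + 1) * wallis_ratio m) * (PI / 2 * wallis_ratio m))
      with (wallis_ratio m ^ 2 * (2 * INR m + 1)) in H1 by (field; repeat split; lra).
    exact H1.
  - apply (Rmult_le_compat_l (2 / PI * (2 * INR m + 2) * wallis_ratio m)) in H2.
    2:{ apply Rlt_le, Rmult_lt_0_compat; [|lra]. apply Rmult_lt_0_compat; [|lra].
        apply Rdiv_lt_0_compat; lra. }
    replace (2 / PI * (2 * INR m + 2) * wallis_ratio m *
       (PI / 2 * (wallis_ratio m * ((2 * INR m + 1) / (2 * INR m + 2)))))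
      with (wallis_ratio m ^ 2 * (2 * INR m + 1)) in H2 by (field; repeat split; lra).
    replace (2 / PI * (2 * INR m + 2) * wallis_ratio m * / ((2 * INR m + 1) * wallis_ratio m))
      with (2 / PI * (1 + / (2 * INR m + 1))) in H2 by (field; repeat split; lra).
    exact H2.
Qed.

Lemma is_lim_seq_wallis_ratio_sq :
  is_lim_seq (fun m => wallis_ratio m ^ 2 * (2 * INR m + 1)) (2 / PI).
Proof.
  apply is_lim_seq_le_le with (fun _ => 2 / PI)
    (fun m => 2 / PI * (1 + / (2 * INR m + 1))).
  - apply wallis_ratio_sq_bounds.
  - apply is_lim_seq_const.
  - replace (Finite (2 / PI)) with (Finite (2 / PI * (1 + 0))) by (f_equal; ring).
    apply (is_lim_seq_scal_l _ (2 / PI) (Finite (1 + 0))).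
    apply is_lim_seq_plus'; [apply is_lim_seq_const|].
    apply is_lim_seq_inv_affine. lra.
Qed.

(** * The logarithm of 2 as a limit of harmonic sums *)

(** The sum of 2/(2j-1) - 1/j over j <= m, which is also twice the alternating
    sum 1 - 1/2 + 1/3 - ... - 1/(2m). *)
Definition log2_gap (m : nat) : R := 2 * odd_harmonic m - harmonic m.

Lemma ln_increment_le (x y : R) : 0 < x -> 0 < y -> ln y - ln x <= (y - x) / x.
Proof.
  intros Hx Hy. rewrite <- ln_div by assumption.
  replace ((y - x) / x) with (y / x - 1) by (field; lra).
  pose proof (exp_ineq1_le (ln (y / x))) as E.
  rewrite exp_ln in E by (apply Rdiv_lt_0_compat; assumption). lra.
Qed.

(** The right-hand side compares with the integrals of 1/x over [m, 2m] and
    [m+1, 2m+1], hence with log 2. *)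
Lemma log2_gap_doubling (m : nat) :
  log2_gap m = 2 * (harmonic (m + m) - harmonic m).
Proof.
  unfold log2_gap. induction m as [|m IH].
  - change (0 + 0)%nat with 0%nat. rewrite odd_harmonic_0, harmonic_0. ring.
  - replace (S m + S m)%nat with (S (S (m + m))) by lia.
    rewrite !harmonic_S, odd_harmonic_S, S_INR, plus_INR.
    pose proof (pos_INR m).
    replace (harmonic (m + m)) with (odd_harmonic m + harmonic m / 2) by lra.
    field. repeat split; lra.
Qed.

Lemma harmonic_diff_upper (m n : nat) :
  harmonic (S m + n) - harmonic (S m)
  <= ln (INR (S m) + INR n) - ln (INR (S m)).
Proof.
  pose proof (pos_INR m). induction n as [|n IH].
  - rewrite Nat.add_0_r. change (INR 0) with 0. rewrite Rplus_0_r. lra.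
  - replace (S m + S n)%nat with (S (S m + n)) by lia.
    rewrite harmonic_S, plus_INR, (S_INR n).
    rewrite S_INR in *. pose proof (pos_INR n).
    pose proof (ln_increment_le (INR m + 1 + (INR n + 1)) (INR m + 1 + INR n)
      ltac:(lra) ltac:(lra)) as E.
    replace ((INR m + 1 + INR n - (INR m + 1 + (INR n + 1)))
      / (INR m + 1 + (INR n + 1))) with (- / (INR m + 1 + INR n + 1)) in E
      by (field; lra).
    lra.
Qed.

Lemma harmonic_diff_lower (m n : nat) :
  ln (INR m + INR n + 1) - ln (INR m + 1) <= harmonic (m + n) - harmonic m.
Proof.
  pose proof (pos_INR m). induction n as [|n IH].
  - rewrite Nat.add_0_r. change (INR 0) with 0. rewrite Rplus_0_r. lra.
  - replace (m + S n)%nat with (S (m + n)) by lia.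
    rewrite harmonic_S, plus_INR, (S_INR n). pose proof (pos_INR n).
    pose proof (ln_increment_le (INR m + INR n + 1) (INR m + (INR n + 1) + 1)
      ltac:(lra) ltac:(lra)) as E.
    replace ((INR m + (INR n + 1) + 1 - (INR m + INR n + 1))
      / (INR m + INR n + 1)) with (/ (INR m + INR n + 1)) in E
      by (field; lra).
    lra.
Qed.

Lemma log2_gap_upper (m : nat) : log2_gap m <= 2 * ln 2.
Proof.
  rewrite log2_gap_doubling. destruct m as [|m].
  - change (0 + 0)%nat with 0%nat. pose proof ln_lt_2. lra.
  - pose proof (harmonic_diff_upper m (S m)) as E. pose proof (pos_INR m).
    replace (INR (S m) + INR (S m)) with (2 * INR (S m)) in E by ring.
    rewrite S_INR, ln_mult in E by lra. lra.
Qed.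

Lemma log2_gap_lower (m : nat) : 2 * ln 2 - 2 * / (2 * INR m + 1) <= log2_gap m.
Proof.
  rewrite log2_gap_doubling.
  pose proof (harmonic_diff_lower m m) as E. pose proof (pos_INR m).
  pose proof (ln_increment_le (INR m + INR m + 1) (2 * (INR m + 1))
    ltac:(lra) ltac:(lra)) as E2.
  rewrite ln_mult in E2 by lra.
  replace ((2 * (INR m + 1) - (INR m + INR m + 1)) / (INR m + INR m + 1))
    with (/ (2 * INR m + 1)) in E2 by (field; lra).
  lra.
Qed.

Lemma is_lim_seq_log2_gap : is_lim_seq log2_gap (2 * ln 2).
Proof.
  apply is_lim_seq_le_le with (fun m => 2 * ln 2 - 2 * / (2 * INR m + 1))
    (fun _ => 2 * ln 2).
  - intros m. split; [apply log2_gap_lower | apply log2_gap_upper].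
  - replace (Finite (2 * ln 2)) with (Finite (2 * ln 2 - 2 * 0))
      by (f_equal; ring).
    apply is_lim_seq_minus'; [apply is_lim_seq_const|].
    apply (is_lim_seq_scal_l _ 2 0). apply is_lim_seq_inv_affine. lra.
  - apply is_lim_seq_const.
Qed.

Lemma log2_gap_bounds (m : nat) : 0 <= log2_gap m <= 2.
Proof.
  split.
  - unfold log2_gap. induction m as [|m IH].
    + rewrite odd_harmonic_0, harmonic_0. lra.
    + rewrite odd_harmonic_S, harmonic_S. pose proof (pos_INR m).
      assert (/ (INR m + 1) <= 2 * / (2 * INR m + 1)).
      { apply (Rmult_le_reg_r ((INR m + 1) * (2 * INR m + 1))); [nra|].
        field_simplify; lra. }
      lra.
  - pose proof (log2_gap_upper m).
    pose proof (ln_increment_le 1 2 ltac:(lra) ltac:(lra)). rewrite ln_1 in *. lra.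
Qed.

(** * Geometric domination of the terms *)

Lemma odd_harmonic_diff (m n : nat) :
  0 <= odd_harmonic (n + m) - odd_harmonic m <= INR n.
Proof.
  induction n as [|n IH].
  - simpl. lra.
  - replace (S n + m)%nat with (S (n + m)) by lia.
    rewrite odd_harmonic_S, S_INR. pose proof (pos_INR (n + m)).
    assert (0 < / (2 * INR (n + m) + 1) <= 1).
    { split; [apply Rinv_0_lt_compat; lra|].
      rewrite <- Rinv_1. apply Rinv_le_contravar; lra. }
    lra.
Qed.

(** The quantity equals
    (o(n+k) - o(k)) + o(n) - [log2_gap (n + k)], where o is [odd_harmonic]: the
    first two parts lie between 0 and n and the last between 0 and 2.  The
    bound has to be uniform in [k], although each harmonic sum is unbounded. *)
Lemma mixed_harmonic_bound (n k : nat) :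
  Rabs (mixed_harmonic n k) <= 2 * (INR n + 1).
Proof.
  unfold mixed_harmonic.
  pose proof (log2_gap_bounds (n + k)) as E1. unfold log2_gap in E1.
  pose proof (odd_harmonic_diff k n) as E2.
  pose proof (odd_harmonic_diff 0 n) as E3.
  rewrite Nat.add_0_r, odd_harmonic_0 in E3. pose proof (pos_INR n).
  apply Rabs_le. lra.
Qed.

Lemma weight_0 (k : nat) : weight 0 k = wallis_ratio k ^ 4 / (INR k + 1).
Proof.
  unfold weight. simpl (0 + k)%nat. simpl (2 * 0 + k + 1)%nat.
  replace (k + 1)%nat with (S k) by lia.
  rewrite wallis_ratio_0, fact_simpl, mult_INR, S_INR. change (INR (fact 0)) with 1.
  pose proof (pos_INR k). pose proof (INR_fact_neq_0 k). simpl pow.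
  field. split; lra.
Qed.

Lemma wallis_ratio_sq_le (m : nat) : wallis_ratio m ^ 2 * (INR m + 1) <= 2.
Proof.
  pose proof (wallis_ratio_sq_bounds m) as [_ E]. pose proof (pos_INR m). pose proof PI2_1.
  assert (/ (2 * INR m + 1) <= 1).
  { rewrite <- Rinv_1. apply Rinv_le_contravar; lra. }
  assert (2 / PI < 1).
  { apply (Rmult_lt_reg_r PI); [lra|]. field_simplify; lra. }
  assert (0 < 2 / PI) by (apply Rdiv_lt_0_compat; lra).
  assert (0 < wallis_ratio m ^ 2) by apply (pow_lt _ 2), wallis_ratio_pos.
  nra.
Qed.

(** The first step, from [n = 0] to [n = 1], gains (k+2)(k+3) on top of
    [weight 0 k] = O(1/(k+1)^3); every later step gains a factor 4, since
    (n+1)^2 is at most a quarter of (2n+k+2)(2n+k+3).  The fifth power of [k+1]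
    is what compensates the cubic growth in [k] of the polynomials in [wz_term]
    with room to spare. *)
Lemma weight_decay (n k : nat) :
  Rabs (weight (S n) k) * (INR k + 1) ^ 5 <= 4 * (/ 4) ^ n.
Proof.
  pose proof (pos_INR k) as Hy.
  assert (Hfrac : forall z, 0 <= z -> 0 <= (2 * z + 1) / (2 * z + 2) <= 1).
  { intros z Hz. split; [apply Rlt_le, Rdiv_lt_0_compat; lra|].
    apply (Rmult_le_reg_r (2 * z + 2)); [lra|]. field_simplify; lra. }
  assert (Hcubes : forall x, 0 <= x ->
    0 <= ((2 * (x + INR k) + 1) / (2 * (x + INR k) + 2)) ^ 3
         * ((2 * x + 1) / (2 * x + 2)) ^ 3 <= 1).
  { intros x Hx. rewrite <- Rpow_mult_distr.
    destruct (Hfrac x Hx) as [? ?].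
    destruct (Hfrac (x + INR k) ltac:(lra)) as [? ?].
    set (u := (2 * x + 1) / (2 * x + 2)) in *.
    set (v := (2 * (x + INR k) + 1) / (2 * (x + INR k) + 2)) in *.
    assert (0 <= v * u <= 1) by nra.
    split; [apply pow_le; lra|].
    rewrite <- (pow1 3). apply pow_incr. lra. }
  assert (Hstep : forall n,
    Rabs (weight (S n) k) <=
    Rabs (weight n k)
    * ((INR n + 1) ^ 2 / ((2 * INR n + INR k + 2) * (2 * INR n + INR k + 3)))).
  { intros m. pose proof (pos_INR m) as Hx. rewrite weight_Sn, Rabs_mult, Rabs_Ropp.
    apply Rmult_le_compat_l; [apply Rabs_pos|].
    set (r := (INR m + 1) ^ 2 / ((2 * INR m + INR k + 2) * (2 * INR m + INR k + 3))).
    assert (0 < r).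
    { apply Rdiv_lt_0_compat; [apply pow_lt; lra|apply Rmult_lt_0_compat; lra]. }
    destruct (Hcubes (INR m) Hx).
    rewrite Rabs_pos_eq by (apply Rmult_le_pos; lra). nra. }
  induction n as [|n IH].
  - specialize (Hstep 0%nat). rewrite weight_0 in Hstep. change (INR 0) with 0 in Hstep.
    pose proof (wallis_ratio_sq_le k).
    assert (0 < wallis_ratio k ^ 2) by apply (pow_lt _ 2), wallis_ratio_pos.
    assert (Hb : (wallis_ratio k ^ 2 * (INR k + 1)) ^ 2 <= 4).
    { replace 4 with (2 ^ 2) by ring. apply pow_incr. split; [nra|assumption]. }
    rewrite (Rabs_pos_eq (wallis_ratio k ^ 4 / (INR k + 1))) in Hstep.
    2:{ apply Rlt_le, Rdiv_lt_0_compat; [apply pow_lt, wallis_ratio_pos|lra]. }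
    apply (Rmult_le_compat_r ((INR k + 1) ^ 5)) in Hstep; [|apply pow_le; lra].
    eapply Rle_trans; [exact Hstep|].
    replace (wallis_ratio k ^ 4 / (INR k + 1) *
      ((0 + 1) ^ 2 / ((2 * 0 + INR k + 2) * (2 * 0 + INR k + 3))) * (INR k + 1) ^ 5)
      with ((wallis_ratio k ^ 2 * (INR k + 1)) ^ 2 *
            ((INR k + 1) ^ 2 / ((INR k + 2) * (INR k + 3))))
      by (field; lra).
    assert (0 <= (INR k + 1) ^ 2 / ((INR k + 2) * (INR k + 3)) <= 1).
    { split; [apply Rlt_le, Rdiv_lt_0_compat; [apply pow_lt; lra|nra]|].
      apply (Rmult_le_reg_r ((INR k + 2) * (INR k + 3))); [nra|].
      field_simplify; nra. }
    pose proof (pow2_ge_0 (wallis_ratio k ^ 2 * (INR k + 1))). rewrite pow_O. nra.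
  - pose proof (pos_INR n). specialize (Hstep (S n)). rewrite S_INR in Hstep.
    assert (Hq : (INR n + 1 + 1) ^ 2 /
       ((2 * (INR n + 1) + INR k + 2) * (2 * (INR n + 1) + INR k + 3)) <= / 4).
    { apply (Rmult_le_reg_r ((2 * (INR n + 1) + INR k + 2) * (2 * (INR n + 1) + INR k + 3)));
      [nra|]. field_simplify; [nra|split; lra]. }
    pose proof (Rabs_pos (weight (S n) k)).
    assert (Rabs (weight (S (S n)) k) <= / 4 * Rabs (weight (S n) k)) by nra.
    assert (0 < (INR k + 1) ^ 5) by (apply pow_lt; lra).
    replace ((/ 4) ^ S n) with (/ 4 * (/ 4) ^ n) by reflexivity.
    nra.
Qed.

(** The constants come from absorbing (n+2)^4 into the geometric factor:
    n + 2 <= 12 (7/6)^n by Bernoulli's inequality, 82944 = 4 * 12^4 and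
    2401/5184 = (7/6)^4 / 4. *)
Definition majorant (n : nat) : R := 82944 * (2401 / 5184) ^ n.

Lemma ex_series_majorant : ex_series majorant.
Proof.
  apply (@ex_series_scal_l R_AbsRing). apply ex_series_geom.
  rewrite Rabs_pos_eq; lra.
Qed.

Lemma weight_majorant (n k : nat) :
  Rabs (weight (S n) k) * ((INR (S n) + 1) ^ 4 * (INR k + 1) ^ 5) <= majorant n.
Proof.
  assert (Hbern : (INR (S n) + 1) ^ 4 <= 20736 * (2401 / 1296) ^ n).
  { replace (2401 / 1296) with ((1 + / 6) ^ 4) by field.
    rewrite <- pow_mult, Nat.mul_comm, pow_mult.
    replace 20736 with (12 ^ 4) by ring. rewrite <- Rpow_mult_distr.
    pose proof (pos_INR n). apply pow_incr. rewrite S_INR.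
    pose proof (poly n (/ 6) ltac:(lra)). lra. }
  unfold majorant.
  replace (2401 / 5184) with (/ 4 * (2401 / 1296)) by field.
  rewrite Rpow_mult_distr.
  replace (82944 * ((/ 4) ^ n * (2401 / 1296) ^ n))
    with (4 * (/ 4) ^ n * (20736 * (2401 / 1296) ^ n)) by ring.
  replace (Rabs (weight (S n) k) * ((INR (S n) + 1) ^ 4 * (INR k + 1) ^ 5))
    with (Rabs (weight (S n) k) * (INR k + 1) ^ 5 * (INR (S n) + 1) ^ 4) by ring.
  pose proof (pos_INR k). pose proof (pos_INR (S n)).
  apply Rmult_le_compat; try assumption.
  - apply Rmult_le_pos; [apply Rabs_pos|apply pow_le; lra].
  - apply pow_le; lra.
  - apply weight_decay.
Qed.

Lemma wz_term_bound (n k : nat) :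
  Rabs (wz_term (S n) k) <= 300 * majorant n * / (1 * INR k + 1).
Proof.
  pose proof (pos_INR (S n)) as Hx. pose proof (pos_INR k) as Hy.
  pose proof (weight_majorant n k) as Hw.
  pose proof (mixed_harmonic_bound (S n) k) as HM.
  unfold wz_term. set (x := INR (S n)) in *. set (y := INR k) in *.
  set (A := 8 * y ^ 3 + _ + _ + _). set (B := 4 * y ^ 2 + _ + _).
  (* The constant 100 is crude: it makes every coefficient of the expanded
     right-hand side dominate that of A.  Then 300 = 2 * 100 + 100. *)
  assert (HA : 0 <= A <= 100 * ((x + 1) ^ 3 * (y + 1) ^ 3)).
  { unfold A. assert (0 <= x * y) by nra.
    assert (0 <= x ^ 2 * y) by (apply Rmult_le_pos; nra).
    assert (0 <= x * y ^ 2) by (apply Rmult_le_pos; nra).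
    assert (0 <= x ^ 2 * y ^ 2) by (apply Rmult_le_pos; nra).
    assert (0 <= x ^ 2) by nra. assert (0 <= y ^ 2) by nra.
    assert (0 <= x ^ 3) by (apply pow_le; lra).
    assert (0 <= y ^ 3) by (apply pow_le; lra).
    assert (0 <= x ^ 3 * y) by (apply Rmult_le_pos; lra).
    assert (0 <= x ^ 3 * y ^ 2) by (apply Rmult_le_pos; lra).
    assert (0 <= x ^ 3 * y ^ 3) by (apply Rmult_le_pos; lra).
    assert (0 <= x * y ^ 3) by (apply Rmult_le_pos; lra).
    assert (0 <= x ^ 2 * y ^ 3) by (apply Rmult_le_pos; lra).
    split; ring_simplify; lra. }
  assert (HB : 0 <= B <= 100 * ((x + 1) ^ 3 * (y + 1) ^ 3)).
  { unfold A, B in *. assert (0 <= x * y) by nra.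
    assert (0 <= x ^ 2) by nra. assert (0 <= y ^ 2) by nra.
    assert (0 <= x ^ 3) by (apply pow_le; lra).
    assert (0 <= y ^ 3) by (apply pow_le; lra).
    assert (0 <= x ^ 2 * y) by (apply Rmult_le_pos; nra).
    assert (0 <= x * y ^ 2) by (apply Rmult_le_pos; nra).
    split; [ring_simplify; lra|].
    eapply Rle_trans; [|apply HA]. ring_simplify; lra. }
  clearbody A B.
  assert (Hpoly : Rabs (mixed_harmonic (S n) k * A - B)
                  <= 300 * ((x + 1) ^ 4 * (y + 1) ^ 3)).
  { unfold Rminus. eapply Rle_trans; [apply Rabs_triang|].
    rewrite Rabs_Ropp, Rabs_mult, (Rabs_pos_eq A), (Rabs_pos_eq B) by lra.
    assert (0 <= (x + 1) ^ 3 * (y + 1) ^ 3)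
      by (apply Rmult_le_pos; apply pow_le; lra).
    replace (300 * ((x + 1) ^ 4 * (y + 1) ^ 3))
      with (2 * (x + 1) * (100 * ((x + 1) ^ 3 * (y + 1) ^ 3))
            + 100 * (x + 1) * ((x + 1) ^ 3 * (y + 1) ^ 3)) by ring.
    apply Rplus_le_compat; [|nra].
    apply Rmult_le_compat; try lra. apply Rabs_pos. }
  rewrite Rabs_mult.
  apply (Rmult_le_reg_r (y + 1)); [lra|].
  replace (300 * majorant n * / (1 * y + 1) * (y + 1)) with (300 * majorant n)
    by (field; lra).
  eapply Rle_trans.
  { apply Rmult_le_compat_r; [lra|].
    apply Rmult_le_compat_l; [apply Rabs_pos | exact Hpoly]. }
  eapply Rle_trans; [|apply Rmult_le_compat_l; [lra|exact Hw]].
  assert (0 <= Rabs (weight (S n) k) * ((x + 1) ^ 4 * (y + 1) ^ 4)).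
  { apply Rmult_le_pos; [apply Rabs_pos|apply Rmult_le_pos; apply pow_le; lra]. }
  replace ((y + 1) ^ 5) with ((y + 1) ^ 4 * (y + 1)) by ring. nra.
Qed.

Lemma wz_cert_bound (n k : nat) : Rabs (wz_cert (S n) k) <= 72 * majorant n.
Proof.
  pose proof (pos_INR (S n)) as Hx. pose proof (pos_INR k) as Hy.
  pose proof (weight_majorant n k) as Hw.
  pose proof (mixed_harmonic_bound (S n) k) as HM.
  unfold wz_cert. set (x := INR (S n)) in *. set (y := INR k) in *.
  assert (Hpoly : Rabs (mixed_harmonic (S n) k * (4 * x + 4 * y + 1) - 1)
                  <= 9 * ((x + 1) ^ 2 * (y + 1))).
  { unfold Rminus. eapply Rle_trans; [apply Rabs_triang|].
    rewrite Rabs_Ropp, Rabs_R1, Rabs_mult, (Rabs_pos_eq (4 * x + 4 * y + 1)) by lra.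
    pose proof (Rabs_pos (mixed_harmonic (S n) k)).
    assert (0 <= x * y) by nra. assert (0 <= x * x * y) by nra.
    apply Rle_trans with (2 * (x + 1) * (4 * (x + 1) * (y + 1)) + 1).
    - apply Rplus_le_compat_r. apply Rmult_le_compat; nra.
    - nra. }
  assert (Hpre : 0 <= 4 * x * (2 * x + y + 1) <= 8 * ((x + 1) ^ 2 * (y + 1))).
  { assert (0 <= x * y) by nra. assert (0 <= x * x * y) by nra. nra. }
  replace (4 * x * (2 * x + y + 1) * weight (S n) k *
    (mixed_harmonic (S n) k * (4 * x + 4 * y + 1) - 1)) with
   (weight (S n) k * (4 * x * (2 * x + y + 1) *
    (mixed_harmonic (S n) k * (4 * x + 4 * y + 1) - 1))) by ring.
  rewrite Rabs_mult, (Rabs_mult (4 * x * (2 * x + y + 1))).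
  rewrite (Rabs_pos_eq (4 * x * (2 * x + y + 1))) by lra.
  eapply Rle_trans.
  { apply Rmult_le_compat_l; [apply Rabs_pos|].
    apply Rmult_le_compat; [lra|apply Rabs_pos|apply Hpre|exact Hpoly]. }
  eapply Rle_trans; [|apply Rmult_le_compat_l; [lra|exact Hw]].
  replace (Rabs (weight (S n) k) *
    (8 * ((x + 1) ^ 2 * (y + 1)) * (9 * ((x + 1) ^ 2 * (y + 1)))))
    with (72 * (Rabs (weight (S n) k) * ((x + 1) ^ 4 * (y + 1) ^ 2))) by ring.
  apply Rmult_le_compat_l; [lra|]. apply Rmult_le_compat_l; [apply Rabs_pos|].
  apply Rmult_le_compat_l; [apply pow_le; lra|].
  apply Rle_pow; [lra|lia].
Qed.

(** * The limit and the evaluation *)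

(** For n = 0 the polynomials factor as (2k+1)^3 and (2k+1)^2, and
    [mixed_harmonic 0 k] is - [log2_gap k]; so the term is
    ([wallis_ratio k]^2 (2k+1))^2 times a factor tending to -4 log 2. *)
Lemma is_lim_seq_wz_term_0 : is_lim_seq (wz_term 0) (- (16 * ln 2 / PI ^ 2)).
Proof.
  apply is_lim_seq_ext with (fun k =>
    (wallis_ratio k ^ 2 * (2 * INR k + 1)) * (wallis_ratio k ^ 2 * (2 * INR k + 1))
    * (- (log2_gap k * (2 - / (1 * INR k + 1))) - / (1 * INR k + 1))).
  { intros k. unfold wz_term, mixed_harmonic, log2_gap. rewrite weight_0.
    change (0 + k)%nat with k. rewrite odd_harmonic_0. change (INR 0) with 0.
    pose proof (pos_INR k). field. lra. }
  replace (Finite (- (16 * ln 2 / PI ^ 2)))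
    with (Finite (2 / PI * (2 / PI) * (- (2 * ln 2 * (2 - 0)) - 0))).
  2:{ f_equal. field. apply PI_neq0. }
  assert (is_lim_seq (fun k => / (1 * INR k + 1)) 0)
    by (apply is_lim_seq_inv_affine; lra).
  apply is_lim_seq_mult'.
  - apply is_lim_seq_mult'; apply is_lim_seq_wallis_ratio_sq.
  - apply is_lim_seq_minus'; [|assumption].
    apply (is_lim_seq_opp _ (2 * ln 2 * (2 - 0))).
    apply is_lim_seq_mult'; [apply is_lim_seq_log2_gap|].
    apply is_lim_seq_minus'; [apply is_lim_seq_const|assumption].
Qed.

(** At k = 0 the factor n!^2 / (2n)! left in [weight n 0] turns the sixth power
    of [wallis_ratio n] into a fifth, the factor 2n+1 cancels, and the sums over
    odd integers in [mixed_harmonic n 0] cancel as well. *)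
Lemma wz_term_k0 (k : nat) :
  wz_term k 0 =
  binom (2 * k) k ^ 5 / (- 2 ^ 12) ^ k *
       ((20 * INR k ^ 2 + 8 * INR k + 1) * harmonic k - 6 * INR k - 1).
Proof.
  unfold wz_term, weight, mixed_harmonic.
  rewrite !Nat.add_0_r, odd_harmonic_0, wallis_ratio_0.
  replace (2 * k + 1)%nat with (S (2 * k)) by lia.
  rewrite fact_simpl, mult_INR, S_INR, mult_INR.
  replace (INR 2) with 2 by (simpl; ring).
  change (INR 0) with 0. change (INR (fact 0)) with 1.
  assert (Hw : binom (2 * k) k = 4 ^ k * wallis_ratio k).
  { unfold wallis_ratio. field. apply pow_nonzero; lra. }
  assert (Hf : INR (fact k) ^ 2 / INR (fact (2 * k)) = / (4 ^ k * wallis_ratio k)).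
  { rewrite <- Hw. unfold binom, Binomial.C.
    replace (2 * k - k)%nat with k by lia.
    pose proof (INR_fact_neq_0 k). pose proof (INR_fact_neq_0 (2 * k)).
    field. split; assumption. }
  assert (Hw0 : wallis_ratio k <> 0) by (apply Rgt_not_eq, wallis_ratio_pos).
  rewrite Hw.
  replace ((- 2 ^ 12) ^ k) with ((-1) ^ k * (4 ^ k) ^ 6).
  2:{ rewrite <- pow_mult, Nat.mul_comm, pow_mult, <- Rpow_mult_distr. f_equal. ring. }
  pose proof (pos_INR k).
  replace (1 * INR (fact k) ^ 2 / ((2 * INR k + 1) * INR (fact (2 * k))))
   with (/ (4 ^ k * wallis_ratio k) / (2 * INR k + 1)).
  2:{ rewrite <- Hf. field. split. apply INR_fact_neq_0. lra. }
  assert (4 ^ k <> 0) by (apply pow_nonzero; lra).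
  assert (Hsign : forall z, z / ((-1) ^ k * (4 ^ k) ^ 6)
                            = (-1) ^ k * (z / (4 ^ k) ^ 6)).
  { intros z. unfold Rdiv. rewrite Rinv_mult, <- pow_inv.
    replace (/ -1) with (-1) by field. ring. }
  rewrite Hsign.
  field. repeat split; try assumption; lra.
Qed.

Theorem theorem1p5 :
  is_series
    (fun k : nat =>
       binom (2 * k) k ^ 5 / (- 2 ^ 12) ^ k *
       ((20 * INR k ^ 2 + 8 * INR k + 1) * harmonic k - 6 * INR k - 1))
    (- (16 * ln 2 / PI ^ 2)).
Proof.
  apply (is_series_ext (fun n => wz_term n 0)); [apply wz_term_k0|].
  apply wz_series with (G := wz_cert) (a := fun n => 300 * majorant n)
    (e := fun k => / (1 * INR k + 1)).
  - apply wz_term_cert.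
  - intros k. unfold wz_cert. change (INR 0) with 0. ring.
  - intros k. apply is_lim_seq_incr_1, is_lim_seq_abs_0.
    apply is_lim_seq_le_le with (fun _ => 0) (fun n => 72 * majorant n).
    + intros n. split; [apply Rabs_pos | apply wz_cert_bound].
    + apply is_lim_seq_const.
    + apply ex_series_lim_0, (@ex_series_scal_l R_AbsRing), ex_series_majorant.
  - apply (@ex_series_scal_l R_AbsRing), ex_series_majorant.
  - apply is_lim_seq_inv_affine. lra.
  - apply wz_term_bound.
  - apply is_lim_seq_wz_term_0.
Qed.
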